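(* Let $s(G)$ be a similarity function with values in $\mathbb{N}$. For every univariate graph polynomial with integer coefficients $P(G;X)=\sum_{i=0}^{s(G)}h_i(G)X^i$ there is a d.p.-equivalent graph polynomial $Q(G;X)=\sum_{i=0}^{s(G)}H_i(G)X^i$ with integer coefficients such that all the roots of $Q(G;X)$ are real (for every graph $G$).
   Context: Graphs are finite, simple and undirected. A graph parameter is a function on graphs invariant under isomorphism. The $h_i(G)$ and $H_i(G)$ are integer-valued graph parameters. Two graphs are similar if they have the same number of vertices, the same number of edges and the same number of connected components. A similarity function with values in $\mathbb{N}$ is a graph parameter $s$ with values in $\mathbb{N}$ such that $s(G)=s(H)$ whenever $G$ and $H$ are similar. Two graph polynomials $P$ and $Q$ are d.p.-equivalent if for every two similar graphs $G_1,G_2$: $P(G_1;X)=P(G_2;X)$ if and only if $Q(G_1;X)=Q(G_2;X)$ (equality of polynomials). *)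

(* Defs.v *)
From mathcomp Require Import all_boot all_order all_algebra.
From mathcomp Require Import reals complex.

Set Implicit Arguments.
Unset Strict Implicit.
Unset Printing Implicit Defensive.

Import GRing.Theory Num.Theory.
Local Open Scope ring_scope.

Record sgraph := SGraph {
  svertex :> finType;
  sedge : rel svertex;
  sedge_sym : symmetric sedge;
  sedge_irrefl : irreflexive sedge }.

Definition isomorphic (G H : sgraph) : Prop :=
  exists2 f : G -> H, bijective f &
    forall x y : G, sedge (f x) (f y) = sedge x y.

Definition graph_parameter (T : Type) (f : sgraph -> T) : Prop :=
  forall G H : sgraph, isomorphic G H -> f G = f H.

Definition edge_set (G : sgraph) : {set {set G}} :=
  [set [set x; y] | x in G, y in G & sedge x y].

Definition nb_components (G : sgraph) : nat := n_comp (@sedge G) predT.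

Definition similar (G H : sgraph) : Prop :=
  [/\ #|G| = #|H|, #|edge_set G| = #|edge_set H|
    & nb_components G = nb_components H].

Definition similarity_function (s : sgraph -> nat) : Prop :=
  graph_parameter s /\ forall G H : sgraph, similar G H -> s G = s H.

Definition graph_poly (s : sgraph -> nat) (h : nat -> sgraph -> int)
    (G : sgraph) : {poly int} :=
  \sum_(0 <= i < (s G).+1) h i G *: 'X^i.

Definition dp_equivalent (P Q : sgraph -> {poly int}) : Prop :=
  forall G1 G2 : sgraph, similar G1 G2 -> (P G1 = P G2 <-> Q G1 = Q G2).

(* In particular the zero polynomial is not real-rooted: every complex number
   is a root of it. *)
Definition real_rooted (p : {poly int}) : Prop :=
  forall (R : realType) (z : R[i]),
    root (map_poly (intr : int -> R[i]) p) z -> complex.Im z = 0.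

(* Main.v *)
Require Import Defs.
From mathcomp Require Import all_boot all_order all_algebra.
From mathcomp Require Import reals complex.

Import GRing.Theory Num.Theory.

(** Since [{poly int}] is countable, P(G) can be encoded injectively by a single
    positive integer c(P(G)).  The polynomial Q(G) = c(P(G)) X^s(G) has no root
    but 0, and among similar graphs, where s is constant, it determines and is
    determined by P(G). *)

Definition poly_code (p : {poly int}) : int := (pickle (polyseq p)).+1%:Z.

Lemma poly_code_inj : injective poly_code.
Proof. by move=> p q [] /(pcan_inj pickleK) /poly_inj. Qed.

(** The successor in [poly_code] secures this even where [pickle] returns 0; a zero code would make
    Q(G) the zero polynomial, which is not real-rooted. *)
Lemma poly_code_neq0 p : poly_code p != 0%R.
Proof. by []. Qed.

(** Makes the coefficients of Q isomorphism invariant, since they encode the whole of P(G). *)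
Lemma graph_poly_parameter (s : sgraph -> nat) (h : nat -> sgraph -> int) :
  graph_parameter s -> (forall i, graph_parameter (h i)) ->
  graph_parameter (graph_poly s h).
Proof.
move=> s_param h_param G H isoGH; rewrite /graph_poly (s_param _ _ isoGH).
by apply: eq_bigr => i _; rewrite (h_param i _ _ isoGH).
Qed.

Lemma graph_poly_monomial (s : sgraph -> nat) (c : sgraph -> int) (G : sgraph) :
  graph_poly s (fun i G => if i == s G then c G else 0%R) G
  = (c G *: 'X^(s G))%R.
Proof.
rewrite /graph_poly big_nat_recr //= eqxx big_nat big1 ?add0r // => i lt_is.
by rewrite ltn_eqF // scale0r.
Qed.

Lemma real_rooted_monomial (c : int) (n : nat) :
  c != 0%R -> real_rooted (c *: 'X^n)%R.
Proof.
move=> c_neq0 R z; rewrite map_polyZ map_polyXn rootZ ?intr_eq0 //.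
(* The dropped conjunct is [0 < n]: for [n = 0] there is no root at all. *)
by rewrite rootE hornerXn expf_eq0 => /andP[_ /eqP->].
Qed.

Theorem theorem4p17 (s : sgraph -> nat) (s_sim : similarity_function s)
    (h : nat -> sgraph -> int) (h_param : forall i : nat, graph_parameter (h i)) :
  exists H : nat -> sgraph -> int,
    [/\ forall i : nat, graph_parameter (H i),
        dp_equivalent (graph_poly s h) (graph_poly s H)
      & forall G : sgraph, real_rooted (graph_poly s H G)].
Proof.
case: s_sim => s_param s_simE.
exists (fun i G => if i == s G then poly_code (graph_poly s h G) else 0%R).
split=> [i G1 G2 isoG|G1 G2 simG|G].
- by rewrite (s_param _ _ isoG) (graph_poly_parameter _ _ s_param h_param _ _ isoG).
- rewrite !(graph_poly_monomial s (fun G => poly_code (graph_poly s h G))).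
  rewrite (s_simE _ _ simG); split=> [-> //|].
  (* Both monomials now have exponent [s G2], so this coefficient reads off the two codes. *)
  move/(congr1 (fun p : {poly int} => p`_(s G2))%R).
  by rewrite !coefZ coefXn eqxx !mulr1 => /poly_code_inj.
- rewrite (graph_poly_monomial s (fun G => poly_code (graph_poly s h G))).
  exact/real_rooted_monomial/poly_code_neq0.
Qed.
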